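(* Let $R$ be a commutative reduced ring with identity which is not an integral domain. Then $AG(R)$ is planar if and only if one of the following statements holds. (1) $R\cong \mathbb{Z}_2\times\mathbb{Z}_2\times\mathbb{Z}_2$. (2) $|\mathrm{Min}(R)|=2$ and one of the minimal prime ideals of $R$ has at most three distinct elements.
   Context: For a commutative ring $R$ with identity, $Z(R)$ is the set of zero-divisors of $R$, $Z(R)^*=Z(R)\setminus\{0\}$, $ann_R(x)=\{r\in R : rx=0\}$, and $\mathrm{Min}(R)$ is the set of minimal prime ideals of $R$. The ring $R$ is reduced if it has no nonzero nilpotent element. The annihilator graph $AG(R)$ is the undirected simple graph with vertex set $Z(R)^*$ in which two distinct vertices $x,y$ are adjacent if and only if $ann_R(xy)\neq ann_R(x)\cup ann_R(y)$. A graph is planar if it has genus $0$, i.e. can be embedded in the sphere; for arbitrary (also infinite) graphs the paper uses Kuratowski's criterion: a graph is planar if and only if it contains no subdivision of $K_{3,3}$ or $K_5$. *)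

(* Defs.v *)
From mathcomp Require Import all_boot all_algebra.
From mathcomp Require Import boolp classical_sets functions cardinality.

Set Implicit Arguments.
Unset Strict Implicit.
Unset Printing Implicit Defensive.

Import GRing.Theory.
Local Open Scope ring_scope.
Local Open Scope classical_set_scope.

Record sgraph := SGraph {
  vertex :> eqType;
  adj : rel vertex;
  adj_sym : symmetric adj;
  adj_irrefl : irreflexive adj }.

Fact complete_sym n : symmetric (fun i j : 'I_n => i != j).
Proof. by move=> i j; rewrite eq_sym. Qed.

Fact complete_irrefl n : irreflexive (fun i j : 'I_n => i != j).
Proof. by move=> i; rewrite eqxx. Qed.

Definition complete_graph n : sgraph :=
  SGraph (@complete_sym n) (@complete_irrefl n).

Definition bipartite_adj m n : rel ('I_m + 'I_n)%type := fun u v =>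
  match u, v with
  | inl _, inr _ | inr _, inl _ => true
  | _, _ => false
  end.

Fact bipartite_sym m n : symmetric (@bipartite_adj m n).
Proof. by case=> ? []. Qed.

Fact bipartite_irrefl m n : irreflexive (@bipartite_adj m n).
Proof. by case. Qed.

Definition complete_bipartite_graph m n : sgraph :=
  SGraph (@bipartite_sym m n) (@bipartite_irrefl m n).

(* [f] places the branch vertices and [p u v] lists, in order from [f u] to   *)
(* [f v], the interior vertices of the path of [G] that replaces the edge uv  *)
(* of [H]; the values of [p] on non-edges are irrelevant.                     *)
Definition contains_subdivision (G H : sgraph) : Prop :=
  exists (f : H -> G) (p : H -> H -> seq G),
    [/\ injective f,
        forall u v, adj u v -> path (@adj G) (f u) (rcons (p u v) (f v)),
        forall u v, adj u v -> uniq (p u v) /\ p v u = rev (p u v),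
        forall u v w, adj u v -> f w \notin p u v
      & forall u v u' v', adj u v -> adj u' v' ->
          (u', v') <> (u, v) -> (u', v') <> (v, u) ->
          forall x, x \in p u v -> x \notin p u' v'].

(* Planarity of a graph of arbitrary cardinality is taken in the sense of     *)
(* Kuratowski's criterion.                                                    *)
Definition planar (G : sgraph) : Prop :=
  ~ contains_subdivision G (complete_bipartite_graph 3 3) /\
  ~ contains_subdivision G (complete_graph 5).

Definition reduced (R : nzRingType) : Prop :=
  forall (x : R) (n : nat), x ^+ n = 0 -> x = 0.

Section CommutativeRing.
Variable R : comNzRingType.

Definition ann (x : R) : set R := [set r | r * x = 0].

Definition zero_divisors : set R := [set x | exists2 r, r != 0 & r * x = 0].

Definition nz_zero_divisors : set R := zero_divisors `\ 0.

Definition AG_adj : rel nz_zero_divisors := fun x y =>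
  (x != y) && `[< ann (val x * val y) <> ann (val x) `|` ann (val y) >].

Fact AG_sym : symmetric AG_adj.
Proof. by move=> x y; rewrite /AG_adj eq_sym mulrC setUC. Qed.

Fact AG_irrefl : irreflexive AG_adj.
Proof. by move=> x; rewrite /AG_adj eqxx. Qed.

Definition AG : sgraph := SGraph AG_sym AG_irrefl.

(* [idealr_closed] already requires the ideal to be proper.                   *)
Definition prime_ideal (P : set R) : Prop :=
  idealr_closed [in P] /\ prime_idealr_closed [in P].

Definition Min : set (set R) :=
  [set P | prime_ideal P /\ forall Q, prime_ideal Q -> Q `<=` P -> Q = P].

End CommutativeRing.

Arguments zero_divisors : clear implicits.
Arguments nz_zero_divisors : clear implicits.
Arguments Min : clear implicits.

Definition ring_isomorphic (R S : nzRingType) : Prop :=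
  exists f : {rmorphism R -> S}, bijective f.

(* Main.v *)
Require Import Defs.
From mathcomp Require Import all_boot all_algebra.
From mathcomp Require Import boolp classical_sets functions cardinality.
From HB Require Import structures.
From mathcomp Require Import ring.

Local Open Scope ring_scope.
Local Open Scope classical_set_scope.
Local Open Scope card_scope.

Set Implicit Arguments.
Unset Strict Implicit.
Import GRing.Theory.

(** In a reduced ring, [x] and [y] are adjacent in the annihilator graph exactly
    when some [r] kills [x * y] but neither [x] nor [y] ([adj_linked],
    [linked_adj]).  Nonzero elements with product 0 are adjacent, through
    [r = 1].

    Suppose that the graph is planar.  If [a1], [a2], [a3] are nonzero with
    pairwise products 0, and [b] differs from 0 and [a1] while
    [b * a2 = b * a3 = 0], then the sets [{a1 + a2, b + a2, a2}] and
    [{a1 + a3, b + a3, a3}] span a [K_{3,3}], all of whose edges are witnessed by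
    [r = a2 + a3].  Hence nothing but 0 and [a1] kills both [a2] and [a3]
    ([planar_orthogonal]).  Then [R a1 = {0, a1}], likewise for [a2] and [a3],
    and the [a_i] are orthogonal idempotents.  The element
    [1 - a1 - a2 - a3] kills all three of them, so it is 0 and the ring is
    [Z_2^3] ([planar_orthogonal_iso]).  If there is no such triple, any nonzero
    [x], [y] with [x * y = 0] have prime annihilators which meet in 0 and are
    therefore the two minimal primes.  If both had more than three elements, three
    nonzero elements from each would span a [K_{3,3}]
    ([planar_two_minimal_primes]).

    Conversely, the obstruction is a count of degrees: a branch vertex of degree
    [k] in a subdivision has [k] distinct neighbours ([branch_neighbours]).  When
    the minimal primes [P] and [Q] are the only ones, [P] and [Q] meet in 0
    because every nonzero element avoids some minimal prime
    ([minimal_prime_avoiding]), and every edge has an end in [P].  If [P] has at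
    most two nonzero elements, a vertex outside [P] has degree at most 2, so all
    branch vertices lie in [P], which has no room for them.  In [Z_2^3] adjacent
    elements are incomparable idempotents, and each element is incomparable with
    at most three others.  That excludes [K_5].  In a subdivided [K_{3,3}] any
    two branch vertices on the same side are comparable, since otherwise one of
    them would be incomparable with four elements; but proper nonzero elements
    of [Z_2^3] form no chain of length 3. *)

(** * Subdivisions *)

Lemma subgraph_subdivision (G H : sgraph) (f : H -> G) :
    injective f -> (forall u v, adj u v -> adj (f u) (f v)) ->
  contains_subdivision G H.
Proof. by move=> finj fadj; exists f, (fun _ _ => [::]); split=> //= u v /fadj->. Qed.

(** The neighbours are the first vertices of the paths that leave the branch
    vertex.  Such a first vertex is interior to its path or is a branch vertex
    adjacent to [u] in [H], which gives the last conclusion. *)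
Lemma branch_neighbours (G H : sgraph) (f : H -> G) (p : H -> H -> seq G) :
    injective f ->
    (forall u v, adj u v -> path (@adj G) (f u) (rcons (p u v) (f v))) ->
    (forall u v w, adj u v -> f w \notin p u v) ->
    (forall u v u' v', adj u v -> adj u' v' ->
      (u', v') <> (u, v) -> (u', v') <> (v, u) ->
      forall x, x \in p u v -> x \notin p u' v') ->
  forall (u : H) (t : seq H), uniq t -> all (adj u) t ->
  exists s : seq G, [/\ uniq s, size s = size t, all (adj (f u)) s
    & forall w, ~~ adj u w -> f w \notin s].
Proof.
move=> finj fpath fNp pdisj u t t_uniq t_adj.
pose g v := head (f v) (p u v).
have gP v : g v = f v \/ g v \in p u v.
  by rewrite /g; case: (p u v) => [|x q] /=; [left | right; rewrite mem_head].
exists (map g t); split.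
- rewrite map_inj_in_uniq // => v w /(allP t_adj) uv /(allP t_adj) uw.
  case: (gP v) => [->|gv]; case: (gP w) => [->|gw].
  + exact: finj.
  + by move=> E; have /negP[] := fNp _ _ v uw; rewrite E.
  + by move=> E; have /negP[] := fNp _ _ w uv; rewrite -E.
  + move=> E; apply: contrapT => vw; have /negP[] : g v \notin p u w.
      apply: (pdisj u v) => // -[]; first by move=> wv; apply: vw.
      by move=> uv'; rewrite -uv' adj_irrefl in uv.
    by rewrite E.
- by rewrite size_map.
- apply/allP=> _ /mapP[v /(allP t_adj) uv ->].
  by move: (fpath _ _ uv); rewrite /g; case: (p u v) => [|x q] /= /andP[].
- move=> w Nuw; apply/mapP=> -[v /(allP t_adj) uv fw].
  case: (gP v) => [|]; rewrite -fw.
    by move/finj=> wv; rewrite wv uv in Nuw.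
  by apply/negP; apply: fNp.
Qed.

(** * Cardinality of sets and of duplicate-free sequences *)

Lemma set_inj_card_le (T U : Type) (A : set T) (B : set U) (f : T -> U) :
  set_fun A B f -> set_inj A f -> A #<= B.
Proof.
move=> fAB finj; have /injfunPex[g] : exists2 f, set_fun A B f & set_inj A f.
  by exists f.
exact: inj_card_le.
Qed.

Lemma card_ge_seq (T : choiceType) (A : set T) (n : nat) (s : seq T) :
  A #<= `I_n -> uniq s -> (forall x, x \in s -> A x) -> (size s <= n)%N.
Proof.
move=> An s_uniq sA; rewrite -card_le_II; apply: card_le_trans An.
case: s s_uniq sA => [|x0 s] s_uniq sA; first by rewrite II0 card_ge0.
apply: (@set_inj_card_le _ _ _ _ (nth x0 (x0 :: s))).
  by move=> i /= i_lt; apply/sA/mem_nth.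
move=> i j /set_mem/= i_lt /set_mem/= j_lt /eqP; rewrite nth_uniq //.
by move/eqP.
Qed.

Lemma card_le_seq (T : choiceType) (A : set T) (s : seq T) :
  A `<=` [set` s] -> A #<= `I_(size s).
Proof.
move=> As; apply: (@set_inj_card_le _ _ _ _ (index^~ s)).
  by move=> x /As; rewrite /= index_mem.
by move=> x y /set_mem/As/= xs /set_mem/As/= ys; apply: index_inj.
Qed.

(** A sequence that cannot be prolonged inside [A] would exhaust [A] and bound
    its cardinality. *)
Lemma exists_seq (T : choiceType) (A : set T) (n : nat) :
  ~ (A #<= `I_n) ->
  exists s : seq T, [/\ uniq s, size s = n.+1 & forall x, x \in s -> A x].
Proof.
elim: n => [|n IHn] NAn.
  move: NAn; rewrite II0 card_le0 => /negP/set0P[x Ax].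
  by exists [:: x]; split=> // y; rewrite inE => /eqP->.
have [|s [s_uniq s_size sA]] := IHn.
  by move=> An; apply: NAn; apply: card_le_trans An _; rewrite card_le_II.
have [x Ax xs] : exists2 x, A x & x \notin s.
  apply: contrapT => Nx; apply: NAn; rewrite -s_size; apply: card_le_seq.
  by move=> x Ax; apply: contrapT => xs; apply: Nx; exists x => //; apply/negP.
exists (x :: s); split; rewrite /= ?xs ?s_size // => y.
by rewrite inE => /predU1P[->|/sA].
Qed.

Lemma size_filter_neq (T : eqType) (x : T) (s : seq T) : uniq s ->
  ((size s).-1 <= size [seq y <- s | y != x])%N.
Proof.
move=> s_uniq; have [xs|xs] := boolP (x \in s).
  by rewrite -(size_rem xs) rem_filter.
rewrite (_ : filter _ s = s) ?leq_pred //; apply/all_filterP/allP => y ys.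
by apply: contraNneq xs => <-.
Qed.

Lemma card_set2 (T : pointedType) (a b : T) : a <> b -> [set a; b] #= `I_2.
Proof.
move=> ab; rewrite card_eq_sym; apply/card_set_bijP.
exists (fun i => if i == 0%N then a else b); split.
- by move=> [|[|]] //= _; [left | right].
- by move=> [|[|i]] [|[|j]] // /set_mem//= ? /set_mem//= ? //= E; case: ab.
- by move=> _ [] ->; [exists 0%N | exists 1%N].
Qed.

(** * Degrees in the Kuratowski graphs *)

Lemma K33_deg3 (u : complete_bipartite_graph 3 3) :
  exists t : seq (complete_bipartite_graph 3 3),
    [/\ uniq t, size t = 3%N & all (adj u) t].
Proof.
have inj_l : injective (@inl 'I_3 'I_3) by move=> ? ? [].
have inj_r : injective (@inr 'I_3 'I_3) by move=> ? ? [].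
case: u => i; [exists (map inr (enum 'I_3)) | exists (map inl (enum 'I_3))].
  by split; [rewrite (map_inj_uniq inj_r) enum_uniq | rewrite size_map size_enum_ord |
             apply/allP=> _ /mapP[j _ ->]].
by split; [rewrite (map_inj_uniq inj_l) enum_uniq | rewrite size_map size_enum_ord |
           apply/allP=> _ /mapP[j _ ->]].
Qed.

Lemma K5_deg4 (u : complete_graph 5) :
  exists t : seq (complete_graph 5), [/\ uniq t, size t = 4%N & all (adj u) t].
Proof.
have := size_filter_neq u (enum_uniq 'I_5); rewrite size_enum_ord => s4.
exists (take 4 [seq v <- enum 'I_5 | v != u]); split.
- exact/take_uniq/filter_uniq/enum_uniq.
- by rewrite size_takel.
- by apply/allP=> v /mem_take; rewrite mem_filter /= eq_sym => /andP[].
Qed.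

(** * Comparability in [Z_2 * Z_2 * Z_2] *)

Lemma Z2P (c : 'Z_2) : c = 0 \/ c = 1.
Proof. by case: c => [[|[|[]]]] // i; [left | right]; apply/val_inj. Qed.

(** The elements are idempotents, ordered by [c <= d] when [c * d = c]; under the
    identification with subsets of a three-element set this is inclusion. *)
Definition incomparable (c d : 'Z_2 * 'Z_2 * 'Z_2) : bool :=
  (c * d != c) && (c * d != d).

Definition cube : seq ('Z_2 * 'Z_2 * 'Z_2) :=
  [seq (ab, c) | ab <- [seq (a, b) | a <- [:: 0; 1], b <- [:: 0; 1]], c <- [:: 0; 1]].

Lemma mem_cube c : c \in cube.
Proof.
by case: c => [[a b] c]; case: (Z2P a) => ->; case: (Z2P b) => ->; case: (Z2P c) => ->.
Qed.

Lemma incomparable_le3 c : (size [seq d <- cube | incomparable c d] <= 3)%N.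
Proof.
suff /allP : all (fun c => size [seq d <- cube | incomparable c d] <= 3)%N cube.
  by apply; exact: mem_cube.
by vm_compute.
Qed.

(** Being incomparable with something rules out 0 and 1; between them there are
    only two levels, the atoms and their complements. *)
Lemma no_chain3 c1 c2 c3 : uniq [:: c1; c2; c3] ->
    has (incomparable c1) cube -> has (incomparable c2) cube ->
    has (incomparable c3) cube ->
  [\/ incomparable c1 c2, incomparable c1 c3 | incomparable c2 c3].
Proof.
move=> u h1 h2 h3; apply/or3P.
have : all (fun c1 => all (fun c2 => all (fun c3 =>
    [&& uniq [:: c1; c2; c3], has (incomparable c1) cube,
        has (incomparable c2) cube & has (incomparable c3) cube] ==>
    [|| incomparable c1 c2, incomparable c1 c3 | incomparable c2 c3])
    cube) cube) cube by vm_compute.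
move=> /allP/(_ _ (mem_cube c1)) /allP/(_ _ (mem_cube c2)) /allP/(_ _ (mem_cube c3)).
by rewrite u h1 h2 h3.
Qed.

(** * Prime ideals as sets *)

Lemma prime_idealP (R : comNzRingType) (P : set R) : prime_ideal P <->
  [/\ P 0, ~ P 1, (forall a u v, P u -> P v -> P (a * u + v))
    & (forall u v, P (u * v) -> P u \/ P v)].
Proof.
split=> [[[P0 P1 PD] PM]|[P0 P1 PD PM]].
  split; first exact/asboolP.
  - by move=> /asboolP; apply/negP.
  - by move=> a u v /asboolP Pu /asboolP Pv; apply/asboolP/PD.
  - by move=> u v /asboolP/PM/orP[]/asboolP; [left | right].
split; first split.
- exact/asboolP.
- by apply/negP=> /asboolP.
- by move=> a u v /asboolP Pu /asboolP Pv; apply/asboolP/PD.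
- by move=> u v /asboolP/PM[] ?; apply/orP; [left | right]; apply/asboolP.
Qed.

(** * Adjacency in a reduced ring *)

Section ReducedRing.
Variable R : comNzRingType.
Hypothesis R_reduced : reduced R.
Implicit Types x y z r s : R.

Lemma sqr_neq0 x : x != 0 -> x * x != 0.
Proof. by apply: contraNneq => xx; apply/eqP/(R_reduced (n := 2)); rewrite expr2. Qed.

(** Adjacency without reference to vertices: in a reduced ring this relation
    already forces both elements to be distinct nonzero zero-divisors
    ([linked_vertex], [linked_neq]). *)
Definition linked x y := exists r, [/\ r * x != 0, r * y != 0 & r * (x * y) = 0].

(** The union of the two annihilators always lies in [ann (x * y)], so the two
    sets differ only by a witness. *)
Lemma adj_linked (v w : AG R) : adj v w -> linked (val v) (val w).
Proof.
move=> /andP[_ /asboolP ann_neq]; apply: contrapT => Nlink; apply: ann_neq.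
rewrite eqEsubset; split=> r /=; rewrite /ann /=.
  move=> rvw; apply: contrapT => /not_orP[rv rw]; apply: Nlink.
  by exists r; split=> //; apply/eqP.
by case=> r0; [rewrite mulrA r0 mul0r | rewrite mulrCA r0 mulr0].
Qed.

Lemma linked_sym x y : linked x y -> linked y x.
Proof. by case=> r [rx ry rxy]; exists r; split=> //; rewrite (mulrC y). Qed.

Lemma linked_vertex x y : linked x y -> x \in nz_zero_divisors R.
Proof.
case=> r [rx ry rxy]; rewrite inE; split.
  by exists (r * y) => //; rewrite -mulrA (mulrC y).
by move=> /= x0; rewrite x0 mulr0 eqxx in rx.
Qed.

(** If [x = y] then [(r x)^2 = 0]. *)
Lemma linked_neq x y : linked x y -> x != y.
Proof.
case=> r [rx _ rxy]; apply: contraNneq (sqr_neq0 rx) => xy.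
by rewrite -xy in rxy; apply/eqP; ring: rxy.
Qed.

Lemma linked_adj (v w : AG R) : linked (val v) (val w) -> adj v w.
Proof.
move=> vw; apply/andP; split.
  by apply: contraNneq (linked_neq vw) => ->.
apply/asboolP => ann_eq; case: vw => r [rv rw rvw].
have : (ann (val v) `|` ann (val w)) r by rewrite -ann_eq.
by case=> r0; [move: rv | move: rw]; rewrite r0 eqxx.
Qed.

Lemma orthogonal_linked x y : x != 0 -> y != 0 -> x * y = 0 -> linked x y.
Proof. by move=> x0 y0 xy; exists 1; rewrite !mul1r. Qed.

Lemma planar_no_K33 (a b : seq R) : planar (AG R) ->
  uniq a -> uniq b -> size a = 3%N -> size b = 3%N ->
  (forall x y, x \in a -> y \in b -> linked x y) -> False.
Proof.
move=> [NK33 _] a_uniq b_uniq a3 b3 ab; apply: NK33.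
have aN (i : 'I_3) : nth 0 a i \in a by rewrite mem_nth ?a3.
have bN (i : 'I_3) : nth 0 b i \in b by rewrite mem_nth ?b3.
have aV i := linked_vertex (ab _ _ (aN i) (bN ord0)).
have bV j := linked_vertex (linked_sym (ab _ _ (aN ord0) (bN j))).
pose f (u : complete_bipartite_graph 3 3) : AG R :=
  match u with inl i => SigSub (aV i) | inr j => SigSub (bV j) end.
apply: (@subgraph_subdivision _ _ f) => [u v|].
  move/(congr1 val); case: u v => [i|i] [j|j] /=.
  - by move/eqP; rewrite nth_uniq ?a3 // => /eqP/val_inj->.
  - by move/eqP; rewrite (negPf (linked_neq (ab _ _ (aN i) (bN j)))).
  - by move/esym/eqP; rewrite (negPf (linked_neq (ab _ _ (aN j) (bN i)))).
  - by move/eqP; rewrite nth_uniq ?b3 // => /eqP/val_inj->.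
by move=> [i|i] [j|j] // _; apply: linked_adj; rewrite //=; last apply: linked_sym;
  apply: ab.
Qed.

(** * Three orthogonal elements *)

(** Otherwise [c + a2] and [d + a3], for [c] and [d] in [{a1, b, 0}], are the two
    sides of a [K_{3,3}]: [r = a2 + a3] multiplies [c + a2] to [a2^2], which is
    nonzero, [d + a3] to [a3^2], and their product to 0. *)
Lemma planar_orthogonal (a1 a2 a3 b : R) : planar (AG R) ->
    a1 != 0 -> a2 != 0 -> a3 != 0 ->
    a1 * a2 = 0 -> a1 * a3 = 0 -> a2 * a3 = 0 ->
  b * a2 = 0 -> b * a3 = 0 -> b = 0 \/ b = a1.
Proof.
move=> planarR a1N a2N a3N a12 a13 a23 b2 b3.
apply: contrapT => /not_orP[/eqP bN /eqP ba1].
have uniq3 (a : R) : uniq [:: a1 + a; b + a; a].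
  have shift c : (c + a == a) = (c == 0) by rewrite -subr_eq0 addrK.
  by rewrite /= !inE negb_or !shift (can_eq (addrK a)) eq_sym ba1 a1N bN.
apply: (planar_no_K33 planarR (uniq3 a2) (uniq3 a3)) => // x y.
have low : forall c : R, c \in [:: a1; b; 0] -> [/\ c * a2 = 0 & c * a3 = 0].
  by move=> c; rewrite !inE => /or3P[]/eqP->; rewrite ?mul0r.
have upP (a z : R) : z \in [:: a1 + a; b + a; a] ->
    exists2 c : R, c \in [:: a1; b; 0] & z = c + a.
  by rewrite !inE => /or3P[]/eqP->; [exists a1 | exists b | exists 0];
    rewrite ?add0r // !inE eqxx ?orbT.
move=> /upP[c /low[c2 c3] ->] /upP[d /low[d2 d3] ->].
exists (a2 + a3); split.
- have -> : (a2 + a3) * (c + a2) = c * a2 + c * a3 + a2 * a3 + a2 * a2 by ring.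
  by rewrite c2 c3 a23 !add0r sqr_neq0.
- have -> : (a2 + a3) * (d + a3) = d * a2 + d * a3 + a2 * a3 + a3 * a3 by ring.
  by rewrite d2 d3 a23 !add0r sqr_neq0.
- have -> : (a2 + a3) * ((c + a2) * (d + a3)) = (c * a2) * d + (c * a3) * d
      + (a2 + a3) * (c * a3 + d * a2 + a2 * a3) by ring.
  by rewrite c2 c3 d2 a23 !(mul0r, addr0, mulr0).
Qed.

(** When [R e = {0, e}], this ideal is a copy of [Z_2], and the map is
    multiplication by [e] read through that copy. *)
Definition chi (e r : R) : 'Z_2 := (r * e != 0)%:R.

Section Chi.
Variable e : R.
Hypothesis e_neq0 : e != 0.
Hypothesis e_span : forall r, r * e = 0 \/ r * e = e.

Lemma atom_idem : e * e = e.
Proof. by case: (e_span e) => // ee; move: (sqr_neq0 e_neq0); rewrite ee eqxx. Qed.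

(** The alternative [2e = e] would give [e = 0]. *)
Lemma atom_double : e + e = 0.
Proof.
case: (e_span 2); rewrite mulr_natl mulr2n //.
by move/eqP; rewrite -subr_eq0 addrK (negPf e_neq0).
Qed.

Lemma chi_eq0 r : r * e = 0 -> chi e r = 0.
Proof. by rewrite /chi => ->; rewrite eqxx. Qed.

Lemma chi_eq1 r : r * e = e -> chi e r = 1.
Proof. by rewrite /chi => ->; rewrite e_neq0. Qed.

Lemma chiD r s : chi e (r + s) = chi e r + chi e s.
Proof.
rewrite /chi mulrDl; case: (e_span r) => ->; case: (e_span s) => ->;
  by rewrite ?(addr0, add0r, atom_double) ?eqxx ?e_neq0; apply/val_inj.
Qed.

Lemma chiM r s : chi e (r * s) = chi e r * chi e s.
Proof.
rewrite /chi -mulrA; case: (e_span s) => ->; rewrite ?mulr0 ?eqxx ?mulr0 //.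
by rewrite e_neq0 mulr1.
Qed.

Lemma chi1 : chi e 1 = 1.
Proof. by apply: chi_eq1; rewrite mul1r. Qed.

Lemma chiK r : (if chi e r == 0 then 0 else e) = r * e.
Proof. by rewrite /chi; case: (e_span r) => ->; rewrite ?eqxx // e_neq0. Qed.
End Chi.

Lemma iso_of_atoms (e1 e2 e3 : R) :
    e1 != 0 -> e2 != 0 -> e3 != 0 ->
    (forall r, r * e1 = 0 \/ r * e1 = e1) ->
    (forall r, r * e2 = 0 \/ r * e2 = e2) ->
    (forall r, r * e3 = 0 \/ r * e3 = e3) ->
    e1 * e2 = 0 -> e1 * e3 = 0 -> e2 * e3 = 0 -> e1 + e2 + e3 = 1 ->
  ring_isomorphic R ('Z_2 * 'Z_2 * 'Z_2)%type.
Proof.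
move=> n1 n2 n3 s1 s2 s3 o12 o13 o23 sum1.
pose f r : 'Z_2 * 'Z_2 * 'Z_2 := (chi e1 r, chi e2 r, chi e3 r).
have fD : nmod_morphism f.
  split=> [|r s]; rewrite /f; first by rewrite !chi_eq0 ?mul0r.
  by rewrite !chiD.
have fM : monoid_morphism f.
  split=> [|r s]; rewrite /f; first by rewrite !chi1.
  by rewrite !chiM.
pose F : {rmorphism R -> ('Z_2 * 'Z_2 * 'Z_2)%type} :=
  HB.pack f (GRing.isNmodMorphism.Build _ _ f fD)
            (GRing.isMonoidMorphism.Build _ _ f fM).
pose pick e (c : 'Z_2) : R := if c == 0 then 0 else e.
exists F; exists (fun c => pick e1 c.1.1 + pick e2 c.1.2 + pick e3 c.2).
  by move=> r; rewrite /pick /= !chiK // -!mulrDr sum1 mulr1.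
have chi_pick e (c : 'Z_2) : e != 0 -> (forall r, r * e = 0 \/ r * e = e) ->
    chi e (pick e c) = c.
  move=> en es; case: (Z2P c) => ->; rewrite /pick ?eqxx.
    by rewrite chi_eq0 ?mul0r.
  by rewrite chi_eq1 ?atom_idem.
have chi_pick0 e e' (c : 'Z_2) : e' * e = 0 -> chi e (pick e' c) = 0.
  by move=> ee'; apply: chi_eq0; rewrite /pick; case: (c == 0); rewrite ?mul0r.
case=> [[c1 c2] c3]; rewrite /= /f /= !chiD // !chi_pick // !chi_pick0 //;
  by rewrite ?(addr0, add0r) // mulrC.
Qed.

(** Multiples of [a1] kill [a2] and [a3], so [R a1 = {0, a1}] by
    [planar_orthogonal].  The element [b] below kills all three [a_i] and can
    therefore only be 0. *)
Lemma planar_orthogonal_iso (a1 a2 a3 : R) : planar (AG R) ->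
    a1 != 0 -> a2 != 0 -> a3 != 0 -> a1 * a2 = 0 -> a1 * a3 = 0 -> a2 * a3 = 0 ->
  ring_isomorphic R ('Z_2 * 'Z_2 * 'Z_2)%type.
Proof.
move=> pl n1 n2 n3 o12 o13 o23.
have o21 : a2 * a1 = 0 by rewrite mulrC.
have o31 : a3 * a1 = 0 by rewrite mulrC.
have o32 : a3 * a2 = 0 by rewrite mulrC.
have s1 r : r * a1 = 0 \/ r * a1 = a1.
  by apply: (planar_orthogonal pl n1 n2 n3); rewrite // -mulrA ?o12 ?o13 mulr0.
have s2 r : r * a2 = 0 \/ r * a2 = a2.
  by apply: (planar_orthogonal pl n2 n1 n3); rewrite // -mulrA ?o21 ?o23 mulr0.
have s3 r : r * a3 = 0 \/ r * a3 = a3.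
  by apply: (planar_orthogonal pl n3 n1 n2); rewrite // -mulrA ?o31 ?o32 mulr0.
have i1 := atom_idem n1 s1; have i2 := atom_idem n2 s2; have i3 := atom_idem n3 s3.
pose b := 1 - (a1 + a2 + a3).
have b1 : b * a1 = 0 by rewrite mulrBl !mulrDl mul1r i1 o21 o31 !addr0 subrr.
have b2 : b * a2 = 0 by rewrite mulrBl !mulrDl mul1r i2 o12 o32 addr0 add0r subrr.
have b3 : b * a3 = 0 by rewrite mulrBl !mulrDl mul1r i3 o13 o23 !add0r subrr.
apply: (iso_of_atoms n1 n2 n3 s1 s2 s3) => //; apply/esym/subr0_eq.
have [//|b_a1] := planar_orthogonal pl n1 n2 n3 o12 o13 o23 b2 b3.
by have := sqr_neq0 n1; rewrite -{1}b_a1 b1 eqxx.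
Qed.

(** * Rings without three orthogonal elements *)

(** If [u * v] kills [x] but neither [u] nor [v] does, then [u x], [v x] and [y]
    form an orthogonal triple. *)
Lemma ann_prime (x y : R) :
    (forall a b c : R, a != 0 -> b != 0 -> c != 0 ->
      a * b = 0 -> a * c = 0 -> b * c = 0 -> False) ->
    x != 0 -> y != 0 -> x * y = 0 ->
  prime_ideal (ann x).
Proof.
move=> no3 x0 y0 xy; apply/prime_idealP; split; rewrite /ann /=.
- by rewrite mul0r.
- by rewrite mul1r; apply/eqP.
- by move=> a u v ux vx; rewrite mulrDl -mulrA ux vx mulr0 addr0.
move=> u v uvx; apply: contrapT => /not_orP[/eqP ux /eqP vx].
apply: (no3 _ _ _ ux vx y0); last 2 first.
- by rewrite -mulrA xy mulr0.
- by rewrite -mulrA xy mulr0.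
have -> : (u * x) * (v * x) = u * v * x * x by ring.
by rewrite uvx mul0r.
Qed.

(** The product of the two annihilators lies in their intersection, which is 0. *)
Lemma prime_contains_ann (Q : set R) (x y : R) : prime_ideal Q ->
    (forall z, z * x = 0 -> z * y = 0 -> z = 0) ->
  ann x `<=` Q \/ ann y `<=` Q.
Proof.
move=> /prime_idealP[Q0 _ _ QM] cap0; apply: contrapT => /not_orP[].
move=> /nonsubset[u [ux Qu]] /nonsubset[v [vy Qv]].
have [|//|//] := QM u v; rewrite (_ : u * v = 0) //; apply: cap0.
  by rewrite mulrAC ux mul0r.
by rewrite -mulrA vy mulr0.
Qed.

Lemma ann_Min (x y : R) : x != 0 -> y != 0 -> x * y = 0 ->
    prime_ideal (ann x) -> prime_ideal (ann y) ->
    (forall z, z * x = 0 -> z * y = 0 -> z = 0) ->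
  Min R = [set ann x; ann y].
Proof.
move=> x0 y0 xy px py cap0.
have Nxy : ~ ann x `<=` ann y.
  move=> /(_ y); rewrite /ann /= mulrC xy => /(_ erefl) yy.
  by move: (sqr_neq0 y0); rewrite yy eqxx.
have Nyx : ~ ann y `<=` ann x.
  move=> /(_ x); rewrite /ann /= xy => /(_ erefl) xx.
  by move: (sqr_neq0 x0); rewrite xx eqxx.
have low Q : prime_ideal Q -> ann x `<=` Q \/ ann y `<=` Q.
  by move=> pQ; apply: prime_contains_ann.
rewrite eqEsubset; split=> P.
  by move=> [pP minP]; case: (low P pP) => sP; [left | right]; rewrite (minP _ _ sP).
case=> ->; split=> // Q pQ QP; rewrite eqEsubset; split=> //.
  by case: (low Q pQ) => // yQ; case: Nyx; apply: subset_trans QP.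
by case: (low Q pQ) => // xQ; case: Nxy; apply: subset_trans QP.
Qed.

(** One of the four elements found by [exists_seq] may be 0. *)
Lemma nonzero_triple (P : set R) : ~ (P #<= `I_3) ->
  exists s : seq R, [/\ uniq s, size s = 3%N & forall x, x \in s -> P x /\ x != 0].
Proof.
move=> /exists_seq[s [s_uniq s4 sP]].
have : (3 <= size [seq x <- s | x != 0%R])%N.
  by have := size_filter_neq (0 : R) s_uniq; rewrite s4.
move=> s3; exists (take 3 [seq x <- s | x != 0]); split.
- by rewrite take_uniq ?filter_uniq.
- by rewrite size_takel.
- by move=> x /mem_take; rewrite mem_filter => /andP[-> /sP].
Qed.

Lemma planar_two_minimal_primes : planar (AG R) ->
    ~ GRing.integral_domain_axiom R ->
    (forall a b c : R, a != 0 -> b != 0 -> c != 0 ->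
      a * b = 0 -> a * c = 0 -> b * c = 0 -> False) ->
  Min R #= `I_2 /\ exists2 P : set R, Min R P & P #<= `I_3.
Proof.
move=> pl Ndom no3.
have [x [y [x0 y0 xy]]] : exists x y, [/\ x != 0, y != 0 & x * y = 0].
  apply: contrapT => Nxy; apply: Ndom => x y xy.
  apply: contrapT => /negP/norP[x0 y0]; apply: Nxy; by exists x, y.
have cap0 z : z * x = 0 -> z * y = 0 -> z = 0.
  move=> zx zy; apply: contrapT => /eqP z0; exact: (no3 z x y).
have px := ann_prime no3 x0 y0 xy.
have py : prime_ideal (ann y).
  by apply: (ann_prime no3 y0 x0); rewrite mulrC.
have MinE := ann_Min x0 y0 xy px py cap0.
rewrite MinE; split.
  apply: card_set2 => xy_ann; move: (sqr_neq0 y0).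
  have : ann y y by rewrite -xy_ann /ann /= mulrC.
  by rewrite /ann /= => ->; rewrite eqxx.
case: (pselect (ann x #<= `I_3)) => [x3|/nonzero_triple[s [su s3 sP]]].
  by exists (ann x) => //; left.
case: (pselect (ann y #<= `I_3)) => [y3|/nonzero_triple[t [tu t3 tP]]].
  by exists (ann y) => //; right.
exfalso; apply: (planar_no_K33 pl su tu s3 t3) => u v /sP[ux u0] /tP[vy v0].
apply: orthogonal_linked => //; apply: cap0.
  by rewrite mulrAC ux mul0r.
by rewrite -mulrA vy mulr0.
Qed.

(** * Minimal primes *)

(** Among the multiplicatively closed sets without 0 which contain [x], take a
    maximal one, [S].  The elements killed by some member of [S] form a prime,
    since [S] absorbs every element that no member of [S] kills.  They form a
    minimal one, since a smaller prime is disjoint from [S] and so must contain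
    each [y] with [s * y = 0]. *)
Lemma minimal_prime_avoiding (x : R) : x != 0 -> exists2 P, Min R P & ~ P x.
Proof.
move=> x0.
(* The last clause makes [x] a member only of nonempty sets, so that the union of
   the empty chain qualifies. *)
pose good (S : set R) :=
  [/\ ~ S 0, forall s t, S s -> S t -> S (s * t) & forall s, S s -> S x].
have [|S [[S0 SM Sx] Smax]] := @Zorn_bigcup R good.
  move=> F Fgood Ftot; split.
  - by case=> S /Fgood[].
  - move=> s t [S FS Ss] [T FT Tt].
    have [ST|TS] := Ftot _ _ FS FT.
      by exists T => //; have [_ TM _] := Fgood _ FT; apply/TM/Tt/ST.
    by exists S => //; have [_ SM _] := Fgood _ FS; apply: SM => //; apply: TS.
  - by move=> s [S FS Ss]; exists S => //; have [_ _ Sx] := Fgood _ FS; apply: Sx Ss.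
have sat T : good T -> S `<=` T -> T `<=` S.
  by move=> gT ST; apply: contrapT => NTS; apply: (Smax T).
have x_nilp n : x ^+ n != 0.
  by apply: contraNneq x0 => /R_reduced->.
have {}Sx : S x.
  apply: contrapT => NSx; have S_empty s : ~ S s by move=> /Sx.
  apply: NSx; apply: (sat [set x ^+ n.+1 | n in setT]); last by exists 0%N.
    split=> [[n _]|_ _ [n _ <-] [m _ <-]|s _].
    - by apply/eqP.
    - by exists (n + m.+1)%N; rewrite // -exprD.
    - by exists 0%N.
  by move=> s /S_empty.
(* By maximality [S] contains all [s * y ^+ n], none of which is 0 in a reduced
   ring. *)
have absorb y : (forall s, S s -> s * y != 0) -> forall s, S s -> S (s * y).
  move=> Sy s Ss; pose T : set R := [set t | exists n s, S s /\ t = s * y ^+ n].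
  apply: (sat T); last by exists 1%N, s.
    split.
    - move=> [n [t [St /esym ty]]]; move: (Sy t St) => /negP; apply; apply/eqP.
      apply: (R_reduced (n := n.+1)).
      by rewrite exprMn exprSr [y ^+ n.+1]exprS mulrACA [t ^+ n * y]mulrC mulrA
         -mulrA ty mulr0.
    - move=> _ _ [n [t [St ->]]] [m [u [Su ->]]].
      by exists (n + m)%N, (t * u); split; [exact: SM | rewrite exprD mulrACA].
    - by move=> _ _; exists 0%N, x; rewrite mulr1.
  by move=> t St; exists 0%N, t; rewrite mulr1.
pose P : set R := [set y | exists2 s, S s & s * y = 0].
have NP y : ~ P y -> forall s, S s -> s * y != 0.
  by move=> Py s Ss; apply/eqP => sy; apply: Py; exists s.
have SP s : S s -> ~ P s.
  by move=> Ss [t St ts]; apply: S0; rewrite -ts; apply: SM.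
exists P; last exact: SP.
split.
  apply/prime_idealP; split.
  - by exists x; rewrite ?mulr0.
  - by case=> s Ss; rewrite mulr1 => s0; apply: S0; rewrite -s0.
  - move=> a u v [s Ss su] [t St tv]; exists (s * t); first exact: SM.
    have -> : s * t * (a * u + v) = a * t * (s * u) + s * (t * v) by ring.
    by rewrite su tv !mulr0 addr0.
  - move=> u v [s Ss suv]; apply: contrapT => /not_orP[/NP Nu /NP Nv].
    by move: (Nv _ (absorb u Nu s Ss)); rewrite -mulrA suv eqxx.
move=> Q /prime_idealP[Q0 _ _ QM] QP; rewrite eqEsubset; split=> // y [s Ss sy].
have [|Qs|//] := QM s y; first by rewrite sy.
by case: (SP s Ss); apply: QP.
Qed.

(** * Rings with two minimal primes *)

Lemma two_minimal_primes_meet0 (P Q : set R) : Min R = [set P; Q] ->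
  forall x, P x -> Q x -> x = 0.
Proof.
move=> MinE x Px Qx; apply: contrapT => /eqP /minimal_prime_avoiding[S].
by rewrite MinE => -[] ->.
Qed.

(** The product [r * (x * y) = 0] lies in [P].  If [r] is in [P], it is not in
    [Q], so [x] or [y] is in [Q] and is killed by [r]. *)
Lemma linked_meets_prime (P Q : set R) (x y : R) :
    prime_ideal P -> prime_ideal Q -> (forall z, P z -> Q z -> z = 0) ->
  linked x y -> P x \/ P y.
Proof.
move=> /prime_idealP[P0 _ PD PM] /prime_idealP[Q0 _ QD QM] cap0 [r [rx ry rxy]].
have PI a u : P u -> P (a * u) by move=> Pu; rewrite -[_ * _]addr0; apply: PD.
have Prxy : P (r * (x * y)) by rewrite rxy.
have [Pr|/PM//] := PM _ _ Prxy.
have QI a u : Q u -> Q (a * u) by move=> Qu; rewrite -[_ * _]addr0; apply: QD.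
have Qrxy : Q (r * (x * y)) by rewrite rxy.
have PQ z : Q z -> r * z = 0.
  by move=> Qz; apply: cap0; [rewrite mulrC; apply: PI | apply: QI].
have [Qr|/QM[]/PQ r0] := QM _ _ Qrxy.
- by move: rx; rewrite (cap0 r Pr Qr) mul0r eqxx.
- by rewrite r0 eqxx in rx.
- by rewrite r0 eqxx in ry.
Qed.

(** At most two vertices lie in [P].  A branch vertex outside [P] would have three
    neighbours, all in [P]; so the branch vertices lie in [P], and they are at
    least three. *)
Lemma small_prime_no_subdivision (P Q : set R) (H : sgraph) :
    Min R = [set P; Q] -> P #<= `I_3 ->
    (forall u : H, exists t, [/\ uniq t, size t = 3%N & all (adj u) t]) ->
    (exists s : seq H, uniq s /\ size s = 3%N) ->
  ~ contains_subdivision (AG R) H.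
Proof.
move=> MinE P3 deg3 [h [h_uniq h3]] [f [p [finj fpath _ fNp pdisj]]].
have [pP _] : Min R P by rewrite MinE; left.
have [pQ _] : Min R Q by rewrite MinE; right.
have cap0 := two_minimal_primes_meet0 MinE.
have no_triple (s : seq (AG R)) : uniq s -> size s = 3%N ->
    (forall v, v \in s -> P (val v)) -> False.
  move=> s_uniq s3 sP; suff : (4 <= 3)%N by [].
  rewrite -[4%N]/(3.+1) -{1}s3 -(size_map val s) -/(size (0 :: map val s)).
  apply: (card_ge_seq P3).
    rewrite /= map_inj_uniq ?s_uniq ?andbT; last exact: val_inj.
    apply/mapP => -[v _ v0]; have := set_mem (valP v); case=> _; apply.
    by rewrite /= -v0.
  move=> x; rewrite inE => /predU1P[->|/mapP[v /sP Pv ->]] //.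
  by have /prime_idealP[] := pP.
have fP u : P (val (f u)).
  apply: contrapT => NPu; have [t [t_uniq t3 t_adj]] := deg3 u.
  have [s [s_uniq ss sadj _]] := branch_neighbours finj fpath fNp pdisj t_uniq t_adj.
  apply: (no_triple s s_uniq); first by rewrite ss.
  move=> v /(allP sadj)/adj_linked uv.
  by case: (linked_meets_prime pP pQ cap0 uv).
apply: (no_triple (map f h)); rewrite ?map_inj_uniq ?size_map //.
by move=> _ /mapP[u _ ->].
Qed.

Lemma small_prime_planar (P Q : set R) : Min R = [set P; Q] -> P #<= `I_3 ->
  planar (AG R).
Proof.
move=> MinE P3; split; apply: (small_prime_no_subdivision MinE P3).
- exact: K33_deg3.
- by have [t [t_uniq t3 _]] := K33_deg3 (inl ord0); exists t.
- move=> u; have [t [t_uniq t4 t_adj]] := K5_deg4 u; exists (take 3 t).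
  split; [exact: take_uniq | by rewrite size_takel ?t4 |].
  by apply/allP=> v /mem_take/(allP t_adj).
- have [t [t_uniq t4 _]] := K5_deg4 ord0.
  by exists (take 3 t); rewrite take_uniq ?size_takel ?t4.
Qed.

(** * The annihilator graph of [Z_2 * Z_2 * Z_2] *)

(** If [x * y = x], whatever kills [x * y] kills [x]. *)
Lemma linked_incomparable (F : {rmorphism R -> ('Z_2 * 'Z_2 * 'Z_2)%type}) x y :
  injective F -> linked x y -> incomparable (F x) (F y).
Proof.
move=> Finj [r [rx ry rxy]]; apply/andP; split; rewrite -rmorphM (inj_eq Finj).
  by apply: contraNneq rx => xyx; rewrite -xyx rxy eqxx.
by apply: contraNneq ry => xyy; rewrite -xyy rxy eqxx.
Qed.

Lemma Z2_cubed_planar :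
  ring_isomorphic R ('Z_2 * 'Z_2 * 'Z_2)%type -> planar (AG R).
Proof.
case=> F /bij_inj Finj.
pose inc (v w : AG R) := incomparable (F (val v)) (F (val w)).
have FV_inj : injective (fun v : AG R => F (val v)) by move=> v w /Finj/val_inj.
have adj_inc v w : adj v w -> inc v w by move/adj_linked/(linked_incomparable Finj).
have inc_le3 v (s : seq (AG R)) : uniq s -> all (inc v) s -> (size s <= 3)%N.
  move=> s_uniq s_inc; apply: leq_trans (incomparable_le3 (F (val v))).
  rewrite -(size_map (fun w => F (val w))); apply: uniq_leq_size.
    by rewrite map_inj_uniq.
  by move=> _ /mapP[w /(allP s_inc) vw ->]; rewrite mem_filter mem_cube andbT.
split=> -[f [p [finj fpath _ fNp pdisj]]]; last first.
  have [t [t_uniq t4 t_adj]] := K5_deg4 ord0.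
  have [s [s_uniq ss s_adj _]] := branch_neighbours finj fpath fNp pdisj t_uniq t_adj.
  suff : (size s <= 3)%N by rewrite ss t4.
  by apply: (inc_le3 (f ord0)) => //; apply/allP=> w /(allP s_adj)/adj_inc.
pose a (i : 'I_3) := f (inl i).
have nbrs i : exists s : seq (AG R),
    [/\ uniq s, size s = 3%N, all (inc (a i)) s & forall j, a j \notin s].
  have [t [t_uniq t3 t_adj]] := K33_deg3 (inl i).
  have [s [s_uniq ss s_adj sN]] := branch_neighbours finj fpath fNp pdisj t_uniq t_adj.
  exists s; split=> //; first by rewrite ss.
    by apply/allP=> w /(allP s_adj)/adj_inc.
  by move=> j; apply: sN.
(* [a j] is not among the three neighbours of [a i] given by [nbrs], and would be
   a fourth element incomparable with it. *)
have comparable i j : ~~ inc (a i) (a j).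
  have [s [s_uniq s3 s_inc sN]] := nbrs i.
  apply/negP => ij; suff : (size (a j :: s) <= 3)%N by rewrite /= s3.
  by apply: (inc_le3 (a i)); rewrite /= ?sN ?ij.
have proper i : has (incomparable (F (val (a i)))) cube.
  have [s [_ s3 s_inc _]] := nbrs i; case: s s3 s_inc => // w s _ /andP[iw _].
  by apply/hasP; exists (F (val w)); rewrite ?mem_cube.
have a_inj i j : (F (val (a i)) == F (val (a j))) = (i == j).
  by rewrite (inj_eq FV_inj) (inj_eq finj).
have a_uniq : uniq [:: F (val (a 0)); F (val (a 1)); F (val (a 2%:R))].
  by rewrite /= !inE !a_inj.
by case: (no_chain3 a_uniq (proper 0) (proper 1) (proper 2%:R));
  apply/negP/comparable.
Qed.
End ReducedRing.

(** * Planar annihilator graphs *)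

Theorem theorem6 (R : comNzRingType)
    (R_reduced : reduced R)
    (R_not_domain : ~ GRing.integral_domain_axiom R) :
  planar (AG R) <->
    (ring_isomorphic R ('Z_2 * 'Z_2 * 'Z_2)%type \/
     (Min R #= `I_2 /\ exists2 P : set R, Min R P & P #<= `I_3)).
Proof.
split=> [pl|[iso|[Min2 [P MinP P3]]]].
- have [[a [b [c [a0 b0 c0 [ab ac bc]]]]]|no3] := pselect (exists a b c : R,
    [/\ a != 0, b != 0, c != 0 & [/\ a * b = 0, a * c = 0 & b * c = 0]]).
    by left; apply: (planar_orthogonal_iso R_reduced pl a0 b0 c0).
  right; apply: planar_two_minimal_primes => // a b c a0 b0 c0 ab ac bc.
  by apply: no3; exists a, b, c.
- exact: Z2_cubed_planar.
move: Min2; rewrite card_eq_sym => /card_set_bijP[f [f_Min _ f_surj]].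
have MinE : Min R = [set f 0%N; f 1%N].
  rewrite eqEsubset; split=> [S /f_surj[[|[|]] // _ <-]|S []->]; [left|right| |] => //;
    exact: f_Min.
have [PE|PE] : P = f 0%N \/ P = f 1%N by move: MinP; rewrite MinE.
  by apply: (@small_prime_planar _ R_reduced P (f 1%N)); rewrite // PE.
by apply: (@small_prime_planar _ R_reduced P (f 0%N)); rewrite // PE setUC.
Qed.
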